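(* Let $G$ be a finite group. Then $G$ is Cay-DS if and only if every quotient group $G/N$ ($N$ a normal subgroup of $G$) is Cay-DS.
   Context: For a finite group $G$ and a subset $S\subseteq G\setminus\{1\}$ with $S=S^{-1}$, the Cayley graph $Cay(G,S)$ has vertex set $G$, with $a,b$ adjacent iff $ab^{-1}\in S$. The spectrum of a graph is the multiset of eigenvalues of its adjacency matrix. A finite group $G$ is Cay-DS if every Cayley graph $\Gamma$ on $G$ is isomorphic to every Cayley graph $\Gamma'$ (on any finite group) with the same spectrum as $\Gamma$. *)

(* Defs.v *)
From HB Require Import structures.
From mathcomp Require Import all_boot all_order all_algebra.
From mathcomp Require Import all_fingroup all_solvable all_field.

Set Implicit Arguments.
Unset Strict Implicit.
Unset Printing Implicit Defensive.

Import GroupScope GRing.Theory.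

(* A graph is given by its adjacency relation on a finite vertex type. *)

Definition adjacency_matrix (V : finType) (e : rel V) : 'M[algC]_#|V| :=
  (\matrix_(i, j) (e (enum_val i) (enum_val j))%:R)%R.

(* Eigenvalues listed with algebraic multiplicity; only meaningful up to
   perm_eq. No eigenvalue is lost by working in algC, since 0/1 matrices have
   algebraic eigenvalues. *)
Definition spectrum (V : finType) (e : rel V) : seq algC :=
  sval (closed_field_poly_normal (char_poly (adjacency_matrix e))).

Lemma char_poly_spectrum (V : finType) (e : rel V) :
  char_poly (adjacency_matrix e) =
    (\prod_(x <- spectrum e) ('X - x%:P))%R.
Proof.
rewrite /spectrum; case: closed_field_poly_normal => s /= {1}->.
by rewrite (monicP (char_poly_monic _)) scale1r.
Qed.

Lemma mem_spectrum (V : finType) (e : rel V) (x : algC) :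
  (x \in spectrum e) = eigenvalue (adjacency_matrix e) x.
Proof. by rewrite eigenvalue_root_char char_poly_spectrum root_prod_XsubC. Qed.

Definition same_spectrum (V W : finType) (e : rel V) (f : rel W) : Prop :=
  perm_eq (spectrum e) (spectrum f).

Definition graph_iso (V W : finType) (e : rel V) (f : rel W) : Prop :=
  exists2 h : V -> W, bijective h & forall x y, f (h x) (h y) = e x y.

(* S^-1 is the set of inverses of elements of S, and G^# is G without 1. *)
Definition connection_set (gT : finGroupType) (G : {group gT})
    (S : {set gT}) : Prop :=
  S \subset G^# /\ S^-1 = S.

(* The vertex type subg_of G is the subtype of elements of G. *)
Definition Cay (gT : finGroupType) (G : {group gT}) (S : {set gT}) :
    rel (subg_of G) :=
  fun a b => sgval a * (sgval b)^-1 \in S.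
Arguments Cay {gT} G S.

Definition CayDS (gT : finGroupType) (G : {group gT}) : Prop :=
  forall S : {set gT}, connection_set G S ->
  forall (hT : finGroupType) (H : {group hT}) (T : {set hT}),
    connection_set H T ->
    same_spectrum (Cay G S) (Cay H T) -> graph_iso (Cay G S) (Cay H T).

(* Main.v *)
(** Blowing up every vertex of a graph into [n] independent copies multiplies
    the nonzero eigenvalues by [n] and otherwise only adds zeros, so cospectral
    graphs have cospectral blow-ups. Pulling a Cayley graph on [K] back along a
    surjective morphism [G -> K] blows it up by the order [n] of the kernel, and
    a Cayley graph on any group [H] is blown up likewise on [H] times a group of
    order [n]. Hence cospectral Cayley graphs on [K] and [H] have isomorphic
    blow-ups when [G] is Cay-DS. Blow-ups cancel: grouping the vertices
    by their neighbourhoods, the classes of the two original graphs correspond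
    and have equal sizes after dividing by [n]. So homomorphic images of Cay-DS
    groups are Cay-DS; the converse direction is the quotient by [N = 1]. *)
Require Import Defs.
From mathcomp Require Import all_boot all_order all_algebra.
From mathcomp Require Import all_fingroup all_solvable all_field.

Import GroupScope.

Set Implicit Arguments.
Unset Strict Implicit.
Unset Printing Implicit Defensive.

(** * Characteristic polynomials and spectra *)

Section CharPoly.

Import GRing.Theory.
Local Open Scope ring_scope.

(** The block matrix [M] with rows ['X, B] and [C, 1] has determinant [\det ('X - B *m C)], by
    clearing [C]. Clearing [B] instead multiplies this by ['X^k] and leaves
    ['X^m * \det ('X - C *m B)]. *)
Lemma char_poly_mulmxC (R : comNzRingType) m k (B : 'M[R]_(m, k))
    (C : 'M[R]_(k, m)) :
  'X^k * char_poly (B *m C) = 'X^m * char_poly (C *m B).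
Proof.
rewrite /char_poly /char_poly_mx !map_mxM.
move: (map_mx polyC B) (map_mx polyC C) => {}B {}C.
pose M := block_mx ('X%:M : 'M_m) B C (1%:M : 'M_k).
have detM : \det M = \det ('X%:M - B *m C).
  transitivity (\det (M *m block_mx 1%:M 0 (- C) 1%:M)).
    by rewrite det_mulmx det_lblock !det1 !mulr1.
  rewrite mulmx_block !mulmx1 !mulmx0 !mul1mx mulmxN subrr !add0r.
  by rewrite det_ublock det1 mulr1.
rewrite -detM -!det_scalar mulrC.
transitivity (\det (M *m block_mx 1%:M (- B) 0 'X%:M)).
  by rewrite det_mulmx det_ublock det1 mul1r.
rewrite mulmx_block !mulmx1 !mulmx0 !mul1mx !addr0 !mulmxN.
by rewrite mul_scalar_mx mul_mx_scalar addNr det_lblock [- _ + _]addrC.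
Qed.

Lemma char_poly_scale (F : fieldType) k (c : F) (A : 'M[F]_k) :
  c != 0 -> char_poly (c *: A) = c ^+ k *: (char_poly A \Po (c^-1 *: 'X)).
Proof.
move=> c0; rewrite /char_poly -[_ \Po _]/(comp_poly _ _) -det_map_mx.
rewrite -mul_polyC polyC_exp -detZ; congr (\det _).
apply/matrixP=> i j; rewrite !mxE rmorphB /= rmorphMn /= comp_polyX comp_polyC.
by rewrite mulrBr polyCM mulrnAr [_ * (_ *: _)]mul_polyC scalerA divff // scale1r.
Qed.

Lemma same_spectrumP (V W : finType) (e : rel V) (f : rel W) :
  same_spectrum e f <->
  char_poly (adjacency_matrix e) = char_poly (adjacency_matrix f).
Proof.
rewrite !char_poly_spectrum; split; first exact: perm_big.
exact: prod_XsubC_eq.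
Qed.

Lemma same_spectrum_card (V W : finType) (e : rel V) (f : rel W) :
  same_spectrum e f -> #|V| = #|W|.
Proof.
move/same_spectrumP/(congr1 (fun p : {poly algC} => size p)).
by rewrite !size_char_poly => -[].
Qed.

End CharPoly.

(** * Blow-ups of graphs: spectra and cancellation *)

Section Blowup.

Local Open Scope nat_scope.

Definition uniform_fibres (n : nat) (V' V : finType) (p : V' -> V) :=
  forall v, #|[set x | p x == v]| = n.

Lemma card_uniform_preim n (V' V : finType) (p : V' -> V) (P : pred V) :
  uniform_fibres n p -> #|[set x | P (p x)]| = #|[set v | P v]| * n.
Proof.
move=> pn; rewrite -sum_nat_const -sum1dep_card.
rewrite (partition_big p P) //=; apply: eq_big => [v|v Pv]; first by rewrite inE.
rewrite -[RHS](pn v) -sum1dep_card; apply: eq_bigl => x.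
by case: eqP => [->|_]; rewrite ?Pv ?andbF.
Qed.

Lemma card_uniform_fibres n (V' V : finType) (p : V' -> V) :
  uniform_fibres n p -> #|V'| = #|V| * n.
Proof. by move/(card_uniform_preim predT); rewrite !cardsE. Qed.

(** Let [P] be the 0/1 matrix of the map [p] and [A] the adjacency matrix of [e]. The blow-up has
    matrix [P *m (A *m P^T)], and [P^T *m P] is the scalar [n] because the fibres are disjoint of
    size [n]. Swapping the two factors therefore yields [n] times [A]. *)
Lemma char_poly_blowup n (V' V : finType) (p : V' -> V)
    (e' : rel V') (e : rel V) :
  uniform_fibres n p -> (forall x y, e' x y = e (p x) (p y)) ->
  ('X^#|V| * char_poly (adjacency_matrix e')
    = 'X^#|V'| * char_poly (n%:R *: adjacency_matrix e))%R.
Proof.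
move=> pn e'E.
pose P : 'M[algC]_(#|V'|, #|V|) :=
  (\matrix_(i, j) (p (enum_val i) == enum_val j)%:R)%R.
have sumP (F : V -> algC) i :
  (\sum_j P i j * F (enum_val j) = F (p (enum_val i)))%R.
  rewrite (bigD1 (enum_rank (p (enum_val i)))) //= mxE enum_rankK eqxx.
  rewrite GRing.mul1r big1 ?GRing.addr0 // => j ne_j.
  rewrite mxE; case: eqP => [E|_]; last by rewrite GRing.mul0r.
  by rewrite E enum_valK eqxx in ne_j.
have adjE : adjacency_matrix e' = (P *m (adjacency_matrix e *m P^T))%R.
  apply/matrixP=> i j; rewrite !mxE e'E.
  rewrite -(sumP (fun v => (e v (p (enum_val j)))%:R%R)).
  apply: eq_bigr => k _; rewrite !mxE.
  congr (_ * _)%R; rewrite -(sumP (fun v => (e (enum_val k) v)%:R%R)).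
  by apply: eq_bigr => l _; rewrite !mxE GRing.mulrC.
have trPP : (P^T *m P = n%:R%:M)%R.
  apply/matrixP=> i j; rewrite !mxE.
  transitivity (\sum_(x : V') ((p x == enum_val i) && (p x == enum_val j))%:R : algC)%R.
    rewrite (reindex (@enum_val _ V')) /=; last first.
      by exists enum_rank => x _; rewrite ?enum_valK ?enum_rankK.
    by apply: eq_bigr => k _; rewrite !mxE -GRing.natrM mulnb.
  rewrite -GRing.natr_sum -GRing.mulrnA; congr (_%:R)%R.
  case: eqP => [<-|ne_ij].
    under eq_bigr do rewrite andbb.
    by rewrite muln1 -[RHS](pn (enum_val i)) -sum1dep_card [RHS]big_mkcond;
      apply: eq_bigr => x _; case: eqP.
  rewrite muln0 big1 // => x _; do 2![case: eqP => //=] => -> E.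
  by case: ne_ij; apply: enum_val_inj.
by rewrite adjE char_poly_mulmxC -mulmxA trPP mul_mx_scalar.
Qed.

Lemma same_spectrum_blowup n (V' V W' W : finType) (p : V' -> V) (q : W' -> W)
    (e' : rel V') (e : rel V) (f' : rel W') (f : rel W) :
  0 < n -> uniform_fibres n p -> uniform_fibres n q ->
  (forall x y, e' x y = e (p x) (p y)) ->
  (forall x y, f' x y = f (q x) (q y)) ->
  same_spectrum e f -> same_spectrum e' f'.
Proof.
move=> n0 pn qn e'E f'E ef; have cVW := same_spectrum_card ef.
have nR0 : (n%:R != 0 :> algC)%R by rewrite Num.Theory.pnatr_eq0 -lt0n.
(* Once this power of ['X] is restored, each side depends only on [n], the number of vertices and
   the characteristic polynomial of the small graph. *)
apply/same_spectrumP; apply: (@GRing.mulfI _ ('X^#|V|)%R).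
  by rewrite -size_poly_eq0 size_polyXn.
rewrite (char_poly_blowup pn e'E) [in RHS]cVW (char_poly_blowup qn f'E).
rewrite (card_uniform_fibres pn) (card_uniform_fibres qn) !char_poly_scale //.
by rewrite (iffLR (same_spectrumP e f) ef) cVW.
Qed.

(** Corresponding fibres are matched position by position in their enumerations. *)
Lemma bij_of_card_fibres (V W C : finType) (phi : V -> C) (psi : W -> C) :
  (forall c, #|[set v | phi v == c]| = #|[set w | psi w == c]|) ->
  exists2 g : V -> W, bijective g & forall v, psi (g v) = phi v.
Proof.
move=> card_eq.
pose A c := [set v | phi v == c]; pose B c := [set w | psi w == c].
have AP v : v \in A (phi v) by rewrite inE.
have lt_ind v : index v (enum (A (phi v))) < #|B (phi v)|.
  by rewrite -card_eq cardE index_mem mem_enum.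
(* The chosen element is its own default for [nth], so no element of [W] is needed in advance; by
   [lt_ind] the default is never reached. *)
have wP v : {w : W | w = nth w (enum (B (phi v))) (index v (enum (A (phi v))))}.
  have:= lt_ind v; rewrite cardE; case: (enum (B _)) => // w0 s lt_s.
  exists (nth w0 (w0 :: s) (index v (enum (A (phi v))))).
  exact: set_nth_default.
pose g v := sval (wP v).
have gE v : g v = nth (g v) (enum (B (phi v))) (index v (enum (A (phi v)))).
  exact: svalP (wP v).
have psig v : psi (g v) = phi v.
  have: g v \in enum (B (phi v)) by rewrite gE mem_nth // -cardE.
  by rewrite mem_enum inE => /eqP.
have g_inj : injective g.
  move=> x y gxy; have pxy : phi x = phi y by rewrite -!psig gxy.
  have:= gE x; rewrite [in RHS]gxy {1}gxy {1}gE pxy => /eqP.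
  rewrite nth_uniq ?enum_uniq -?cardE ?lt_ind //; last by rewrite -pxy.
  move/eqP=> ixy.
  rewrite -(nth_index x (_ : x \in enum (A (phi y)))); last first.
    by rewrite mem_enum -pxy.
  by rewrite -ixy nth_index // mem_enum.
exists g => //; apply: inj_card_bij => //.
rewrite -sum1_card -[leqRHS]sum1_card (partition_big psi predT) //=.
rewrite [leqRHS](partition_big phi predT) //=; apply: leq_sum => c _.
by rewrite !sum1dep_card card_eq.
Qed.

Lemma graph_iso_blowup_cancel n (V' V W' W : finType)
    (p : V' -> V) (q : W' -> W)
    (e' : rel V') (e : rel V) (f' : rel W') (f : rel W) :
  0 < n -> uniform_fibres n p -> uniform_fibres n q ->
  (forall x y, e' x y = e (p x) (p y)) ->
  (forall x y, f' x y = f (q x) (q y)) ->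
  symmetric f -> graph_iso e' f' -> graph_iso e f.
Proof.
move=> n0 pn qn e'E f'E f_sym [h [k hK kK] hE].
have surj_of (U' U : finType) (r : U' -> U) :
    uniform_fibres n r -> forall v, exists x, r x == v.
  move=> rn v; have: 0 < #|[set x | r x == v]| by rewrite rn.
  by case/card_gt0P=> x; rewrite inE; exists x.
have [s sK] : {s : V -> V' | cancel s p}.
  by exists (fun v => xchoose (surj_of _ _ _ pn v)) => v;
    apply/eqP/(xchooseP (surj_of _ _ _ pn v)).
have fh x y : f (q (h x)) (q (h y)) = e (p x) (p y) by rewrite -f'E hE e'E.
(* Vertices of [W] are classified by neighbourhood. Points in one fibre of [p] have the same
   neighbours upstairs, so [q \o h] sends them into one class, although perhaps to different
   vertices. *)
pose tw w := [set u | f w u].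
have twh x y : p x = p y -> tw (q (h x)) = tw (q (h y)).
  move=> pxy; apply/setP=> u; rewrite !inE.
  have [z /eqP <-] := surj_of _ _ _ qn u.
  by rewrite -(kK z) !fh pxy.
have [g g_bij gE] : exists2 g : V -> W, bijective g &
    forall v, tw (g v) = tw (q (h (s v))).
  (* Multiplied by [n], both sides count points upstairs, in [V'] and in [W'], and [h] matches these
     points. *)
  apply: bij_of_card_fibres => c; apply/eqP; rewrite -(eqn_pmul2r n0).
  rewrite -(card_uniform_preim (fun v => tw (q (h (s v))) == c) pn).
  rewrite -(card_uniform_preim (fun w => tw w == c) qn).
  apply/eqP; rewrite -(card_imset _ (can_inj hK)); congr #|pred_of_set _|.
  apply/setP=> z; rewrite inE; apply/imsetP/idP => [[x + ->]|cz].
    by rewrite inE (twh _ x) ?sK.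
  by exists (k z); rewrite ?kK // inE (twh _ (k z)) ?sK // kK.
exists g => // x y.
(* Adjacency depends only on the class of each endpoint; symmetry of [f] covers the second one. *)
have twE u v w : tw u = tw v -> f u w = f v w.
  by move/setP/(_ w); rewrite !inE.
rewrite (twE _ _ _ (gE x)) f_sym (twE _ _ _ (gE y)) f_sym.
by rewrite fh !sK.
Qed.

End Blowup.

(** * Cayley graphs and surjective morphisms *)

Lemma Cay_sym (gT : finGroupType) (G : {group gT}) (S : {set gT}) :
  connection_set G S -> symmetric (Cay G S).
Proof. by move=> [_ SV] x y; rewrite /Cay -[in LHS]SV inE invMg invgK. Qed.

(** The fibres are the right cosets of the kernel, so they share one size, which the order of [aT]
    forces to be [n]. *)
Lemma uniform_fibres_morph (aT rT : finGroupType) (p : aT -> rT) n :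
  {morph p : x y / x * y} -> (forall y, exists x, p x = y) ->
  #|aT| = (#|rT| * n)%N -> uniform_fibres n p.
Proof.
move=> pM p_surj card_aT.
have fibE y : #|[set x | p x == y]| = #|[set x | p x == 1]|.
  have [x0 <-] := p_surj y.
  rewrite -(card_rcoset [set x | p x == 1] x0); congr #|pred_of_set _|.
  apply/setP=> x; rewrite mem_rcoset !inE -{1}(mulgKV x0 x).
  by rewrite (pM _ x0) eq_mulgV1 mulgK.
have: uniform_fibres #|[set x | p x == 1]| p by move=> y; apply: fibE.
move/card_uniform_fibres; rewrite card_aT => /eqP.
rewrite eqn_pmul2l; last by apply/card_gt0P; exists 1.
by move/eqP=> -> y; apply: fibE.
Qed.

(** The connection set is the preimage of [S] in [G]; it avoids 1 because [S] does. Taking [f] as a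
    plain function, multiplicative on [G], lets [fst] and [coset N] be used directly. *)
Lemma Cay_pullback (gT rT : finGroupType) (G : {group gT}) (K : {group rT})
    (f : gT -> rT) (n : nat) (S : {set rT}) :
  {in G &, {morph f : x y / x * y}} -> f @: G = K -> #|G| = (#|K| * n)%N ->
  connection_set K S ->
  exists (S' : {set gT}) (p : subg_of G -> subg_of K),
    [/\ connection_set G S', uniform_fibres n p &
        forall x y, Cay G S' x y = Cay K S (p x) (p y)].
Proof.
move=> fM fG cardG [SK SV].
have fK x : x \in G -> f x \in K by move=> Gx; rewrite -fG imset_f.
have f1 : f 1 = 1 by apply: (mulgI (f 1)); rewrite -fM ?group1 // !mulg1.
have fV x : x \in G -> f x^-1 = (f x)^-1.
  by move=> Gx; apply: (mulgI (f x)); rewrite -fM ?groupV // !mulgV.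
pose p (x : subg_of G) : subg_of K := subg K (f (sgval x)).
have pE x : sgval (p x) = f (sgval x) by rewrite subgK // fK ?subgP.
exists [set x in G | f x \in S], p; split.
- split.
    apply/subsetP=> x; rewrite !inE => /andP[-> fxS]; rewrite andbT.
    apply/eqP=> x1; move: (subsetP SK _ fxS).
    by rewrite x1 f1 !inE eqxx.
  apply/setP=> x; rewrite !inE groupV; case Gx: (x \in G) => //=.
  by rewrite fV // -[in RHS]SV inE.
- apply: uniform_fibres_morph => [x y|y|].
  + by apply: val_inj; rewrite /= !pE fM ?subgP.
  + have: sgval y \in f @: G by rewrite fG subgP.
    case/imsetP=> x Gx yE; exists (subg G x); apply: val_inj.
    by rewrite /= pE subgK.
  + by rewrite !card_sub.
- move=> x y; rewrite /Cay !pE inE groupM ?groupV ?subgP //=.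
  by rewrite fM ?groupV ?subgP // fV ?subgP.
Qed.

Lemma CayDS_image (gT rT : finGroupType) (G : {group gT}) (K : {group rT})
    (f : gT -> rT) :
  {in G &, {morph f : x y / x * y}} -> f @: G = K -> CayDS G -> CayDS K.
Proof.
move=> fM fG DS_G S connS hT H T connT ST.
pose fm := Morphism fM; pose N := 'ker fm.
have cardG : #|G| = (#|K| * #|N|)%N.
  have <- : fm @* G = K by rewrite morphimEdom.
  rewrite -(card_isog (first_isog fm)) card_quotient ?ker_norm //.
  by rewrite mulnC Lagrange // subsetIl.
(* The kernel itself is the second factor, so both blow-ups have multiplicity [#|N|]. *)
have fstG : fst @: setX H N = H.
  apply/setP=> x; apply/imsetP/idP => [[[y z] /setXP[Hy _] -> //] | Hx].
  by exists (x, 1); rewrite // inE Hx group1.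
have [S' [p [connS' pn S'E]]] := Cay_pullback fM fG cardG connS.
have [T' [q [connT' qn T'E]]] := Cay_pullback (G := setX_group H [group of N])
  (fun x y _ _ => erefl) fstG (cardsX H N) connT.
apply: (graph_iso_blowup_cancel (cardG_gt0 [group of N]) pn qn S'E T'E).
  exact: Cay_sym.
apply: DS_G => //.
exact: same_spectrum_blowup (cardG_gt0 [group of N]) pn qn S'E T'E ST.
Qed.

Theorem theorem2p4 (gT : finGroupType) (G : {group gT}) :
  CayDS G <-> forall N : {group gT}, N <| G -> CayDS (G / N)%G.
Proof.
split=> [DS_G N /andP[_ nNG] | DS_quo].
  apply: (CayDS_image (f := coset N)) DS_G => [x y Gx Gy|].
    by rewrite morphM ?(subsetP nNG).
  by rewrite /= -morphimEsub.
(* [G / 1] lives in a different group type, so the property is carried back to [G] along an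
   isomorphism. *)
have /isogP[f _ fG] : G / 1 \isog G by rewrite isog_sym quotient1_isog.
apply: (CayDS_image (f := f)) (DS_quo 1%G (normal1 G)) => [x y Gx Gy|].
  by rewrite morphM.
by rewrite -morphimEdom.
Qed.
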